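(* Let $Q\in\mathfrak X_{(0,1)}(\mathcal B_{\mathbf Q})$ be the gauge BRST operator. Then $$[Q,Q]\equiv2Q^2\equiv0,$$ i.e. $Q$ is a cohomological vector field with respect to the gauge ghost degree.
   Context: Setting. $(M,g)$ is a spacetime (smooth, connected, time-orientable Lorentzian manifold) with $g_{\mu\nu}=\eta_{\mu\nu}+\varkappa h_{\mu\nu}$ ($\eta$ Minkowski background metric, $h$ graviton). $G\cong U(1)\times\widetilde G$ (with $\widetilde G$ compact semisimple) is the gauge group, $\mathfrak g$ its Lie algebra with structure constants $f^a{}_{bc}$, $\mathrm g$ the gauge coupling constant, $\xi$ a gauge fixing parameter. The fields are sections of the globally trivial $\mathbb Z^2$-graded super bundle $\mathcal B_{\mathbf Q}\to M$; with bidegree (graviton-ghost degree, gauge ghost degree): $h_{\mu\nu}$, vielbein $e$, gauge boson $A^a_\mu$, Higgs/Goldstone vector $\Phi$, fermion vector $\Psi$, auxiliary (Lautrup–Nakanishi) fields $B^\rho$, $b_a$ of degree $(0,0)$; graviton-ghost $C_\rho$: $(1,0)$; graviton-antighost $\overline C^\rho$: $(-1,0)$; gauge ghost $c^a$: $(0,1)$; gauge antighost $\overline c_a$: $(0,-1)$. Parity is total degree mod 2 (odd ghosts anticommute); gauge indices are raised and lowered with $\delta_{ab}$. $\mathfrak X_{(i,j)}(\mathcal B_{\mathbf Q})$ denotes super vector fields of bidegree $(i,j)$, acting as superderivations on graded-symmetric polynomial functionals of the fields and their derivatives. The supercommutator is $[X_1,X_2]=X_1X_2-(-1)^{p_1p_2}X_2X_1$.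 An odd vector field $\Xi$ of degree $1$ with $[\Xi,\Xi]=2\Xi^2=0$ is called cohomological. Gauge BRST operator $Q$ (commuting with $\partial_\mu$): $QA^a_\mu=\frac1\xi\partial_\mu c^a+\mathrm gf^a{}_{bc}c^bA^c_\mu$; $Qc^a=\frac{\mathrm g}2f^a{}_{bc}c^bc^c$; $Q\overline c_a=\frac1\xi b_a$; $Qb_a=0$; $Q\delta_{ab}=0$; $Qh_{\mu\nu}=QC_\rho=Q\overline C^\rho=QB^\rho=Q\eta_{\mu\nu}=Q\Gamma^\rho{}_{\mu\nu}=0$; $Q\Phi=\mathrm gc^a(\mathfrak H_a\cdot\Phi)$; $Q\Psi=\mathrm gc^a(\mathfrak S_a\cdot\Psi)$, where $\mathfrak H_a,\mathfrak S_a$ are the infinitesimal actions (Lie algebra representations of $\mathfrak g$) of the gauge group on the Higgs bundle and on the twisted spinor bundle. *)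

(* Defs.v *)
From HB Require Import structures.
From mathcomp Require Import all_boot all_order all_algebra.
From mathcomp Require Import generic_quotient.
From mathcomp Require Import boolp reals.
From mathcomp Require Import complex.

Set Implicit Arguments.
Unset Strict Implicit.
Unset Printing Implicit Defensive.

Import Order.TTheory GRing.Theory Num.Theory.
Local Open Scope ring_scope.
Local Open Scope quotient_scope.

Section LieAlgebra.
Variables (R : realType) (gg : vectType R).

Record is_lie_bracket (br : gg -> gg -> gg) : Prop := IsLieBracket {
  lie_linearl : forall (a : R) x y z, br (a *: x + y) z = a *: br x z + br y z;
  lie_linearr : forall (a : R) x y z, br z (a *: x + y) = a *: br z x + br z y;
  lie_alt : forall x, br x x = 0;
  lie_jacobi : forall x y z, br x (br y z) + br y (br z x) + br z (br x y) = 0 }.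

(* f^a_bc, i.e. [t_b, t_c] = \sum_a f^a_bc t_a *)
Definition struct_const (br : gg -> gg -> gg) n (t : n.-tuple gg)
  (a b c : 'I_n) : R := coord t a (br t`_b t`_c).

(* trace of [ad x \o ad y] *)
Definition killing (br : gg -> gg -> gg) (x y : gg) : R :=
  \sum_(i < \dim {:gg})
    coord (vbasis {:gg}) i (br x (br y (vbasis {:gg})`_i)).

(* Lie algebra of a group U(1) x G' with G' compact semisimple: a central line
   plus a complementary ideal which is compact semisimple, i.e. on which the
   Killing form is negative definite (the Killing form of an ideal is the
   restriction of the ambient one). *)
Definition u1_plus_compact_semisimple (br : gg -> gg -> gg) : Prop :=
  exists (z : gg) (I : {vspace gg}),
    [/\ z != 0 /\ (forall x, br z x = 0),
        forall x y, y \in I -> br x y \in I,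
        (<[z]> + I = fullv)%VS /\ (<[z]> :&: I = 0)%VS
      & forall x, x \in I -> x != 0 -> killing br x x < 0].

Record is_lie_rep (br : gg -> gg -> gg) N (rho : gg -> 'M[R[i]]_N) : Prop :=
  IsLieRep {
    lie_rep_linear : forall (a : R) x y,
      rho (a *: x + y) = real_complex R a *: rho x + rho y;
    lie_rep_bracket : forall x y,
      rho (br x y) = rho x *m rho y - rho y *m rho x }.

End LieAlgebra.

(* The complex functions on a coordinate domain of the (d+1)-dimensional
   spacetime with the coordinate derivatives; the instance to have in mind is
   the algebra of smooth complex functions with [coord_pd mu] the partial
   derivative along x^mu. *)
Record coord_algebra (R : realType) (d : nat) := CoordAlgebra {
  coord_fun :> comAlgType R[i];
  coord_pd : 'I_d.+1 -> {linear coord_fun -> coord_fun};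
  coord_pdM : forall mu (p q : coord_fun),
    coord_pd mu (p * q) = coord_pd mu p * q + p * coord_pd mu q;
  coord_pdC : forall mu nu (p : coord_fun),
    coord_pd mu (coord_pd nu p) = coord_pd nu (coord_pd mu p) }.

(* Components of the fields (nG = dim of the gauge algebra, nH and nS = ranks
   of the Higgs and of the twisted spinor bundle).  The inverse metric is not
   a field of its own: it is tied to the graviton below. *)
Inductive field (d nG nH nS : nat) : Type :=
| Graviton of 'I_d.+1 & 'I_d.+1
| InvMetric of 'I_d.+1 & 'I_d.+1
| Vielbein of 'I_d.+1 & 'I_d.+1
| GaugeBoson of 'I_nG & 'I_d.+1
| Higgs of 'I_nH
| Fermion of 'I_nS
| GravAux of 'I_d.+1
| GaugeAux of 'I_nG
| GravGhost of 'I_d.+1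
| GravAntighost of 'I_d.+1
| GaugeGhost of 'I_nG
| GaugeAntighost of 'I_nG.

Arguments Graviton {d nG nH nS}.
Arguments InvMetric {d nG nH nS}.
Arguments Vielbein {d nG nH nS}.
Arguments GaugeBoson {d nG nH nS}.
Arguments Higgs {d nG nH nS}.
Arguments Fermion {d nG nH nS}.
Arguments GravAux {d nG nH nS}.
Arguments GaugeAux {d nG nH nS}.
Arguments GravGhost {d nG nH nS}.
Arguments GravAntighost {d nG nH nS}.
Arguments GaugeGhost {d nG nH nS}.
Arguments GaugeAntighost {d nG nH nS}.

(* (graviton-ghost degree, gauge ghost degree) *)
Definition field_bideg d nG nH nS (phi : field d nG nH nS) : int * int :=
  match phi with
  | GravGhost _ => (1, 0)
  | GravAntighost _ => (-1, 0)
  | GaugeGhost _ => (0, 1)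
  | GaugeAntighost _ => (0, -1)
  | _ => (0, 0)
  end.

Definition parity (s : int * int) : bool := odd (absz (s.1 + s.2)).

Definition minkowski (K : pzRingType) d (mu nu : 'I_d.+1) : K :=
  if mu == nu then (if mu == ord0 then 1 else -1) else 0.

Section Functionals.
Variables (R : realType) (d : nat) (O : coord_algebra R d) (nG nH nS : nat).
Variable kappa : R.

Definition scal (r : R[i]) : O := r%:A.
Definition rscal (r : R) : O := scal (real_complex R r).

Inductive expr : Type :=
| Fun of O
| Var of field d nG nH nS
| Add of expr & expr
| Mul of expr & expr
| Der of 'I_d.+1 & expr.

Inductive expr_hom : int * int -> expr -> Prop :=
| hom_zero s : expr_hom s (Fun 0)
| hom_fun p : expr_hom (0, 0) (Fun p)
| hom_var phi : expr_hom (field_bideg phi) (Var phi)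
| hom_add s x y : expr_hom s x -> expr_hom s y -> expr_hom s (Add x y)
| hom_mul s s' x y : expr_hom s x -> expr_hom s' y ->
    expr_hom (s.1 + s'.1, s.2 + s'.2) (Mul x y)
| hom_der s mu x : expr_hom s x -> expr_hom s (Der mu x).

Definition emetric (mu nu : 'I_d.+1) : expr :=
  Add (Fun (minkowski O mu nu))
      (Mul (Fun (rscal kappa)) (Var (Graviton mu nu))).

(* The functionals are the classes of expressions modulo [eqv]: the laws of an
   associative algebra over the coordinate functions with commuting
   derivations, supercommutativity, the symmetry of the metric, g^{-1} g = 1
   and eta_mn e^m_mu e^n_nu = g_munu. *)
Inductive eqv : expr -> expr -> Prop :=
| eqv_refl x : eqv x x
| eqv_sym x y : eqv x y -> eqv y x
| eqv_trans x y z : eqv x y -> eqv y z -> eqv x z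
| eqv_add x x' y y' : eqv x x' -> eqv y y' -> eqv (Add x y) (Add x' y')
| eqv_mul x x' y y' : eqv x x' -> eqv y y' -> eqv (Mul x y) (Mul x' y')
| eqv_der mu x x' : eqv x x' -> eqv (Der mu x) (Der mu x')
| eqv_addC x y : eqv (Add x y) (Add y x)
| eqv_addA x y z : eqv (Add x (Add y z)) (Add (Add x y) z)
| eqv_add0 x : eqv (Add (Fun 0) x) x
| eqv_mulA x y z : eqv (Mul x (Mul y z)) (Mul (Mul x y) z)
| eqv_mulDl x y z : eqv (Mul (Add x y) z) (Add (Mul x z) (Mul y z))
| eqv_mulDr x y z : eqv (Mul x (Add y z)) (Add (Mul x y) (Mul x z))
| eqv_mul1 x : eqv (Mul (Fun 1) x) x
| eqv_mul0 x : eqv (Mul (Fun 0) x) (Fun 0)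
| eqv_funC p x : eqv (Mul (Fun p) x) (Mul x (Fun p))
| eqv_funD p q : eqv (Fun (p + q)) (Add (Fun p) (Fun q))
| eqv_funM p q : eqv (Fun (p * q)) (Mul (Fun p) (Fun q))
| eqv_derD mu x y : eqv (Der mu (Add x y)) (Add (Der mu x) (Der mu y))
| eqv_derM mu x y :
    eqv (Der mu (Mul x y)) (Add (Mul (Der mu x) y) (Mul x (Der mu y)))
| eqv_derC mu nu x : eqv (Der mu (Der nu x)) (Der nu (Der mu x))
| eqv_der_fun mu p : eqv (Der mu (Fun p)) (Fun (coord_pd O mu p))
| eqv_swap s s' x y : expr_hom s x -> expr_hom s' y ->
    eqv (Mul x y) (Mul (Fun ((-1) ^+ (parity s && parity s'))) (Mul y x))
| eqv_graviton mu nu :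
    eqv (Var (Graviton mu nu)) (Var (Graviton nu mu))
| eqv_invmetric mu nu :
    eqv (Var (InvMetric mu nu)) (Var (InvMetric nu mu))
| eqv_invmetricK rho nu :
    eqv (\big[Add/Fun 0]_(sigma < d.+1)
           Mul (Var (InvMetric rho sigma)) (emetric sigma nu))
        (Fun (rho == nu)%:R)
| eqv_vielbein mu nu :
    eqv (\big[Add/Fun 0]_(m < d.+1) \big[Add/Fun 0]_(n < d.+1)
           Mul (Fun (minkowski O m n))
             (Mul (Var (Vielbein m mu)) (Var (Vielbein n nu))))
        (emetric mu nu).

Definition eqvb : rel {classic expr} := fun x y => `[< eqv x y >].

Lemma eqvb_refl : reflexive eqvb.
Proof. by move=> x; apply/asboolP; exact: eqv_refl. Qed.

Lemma eqvb_sym : symmetric eqvb.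
Proof. by move=> x y; apply/asboolP/asboolP; exact: eqv_sym. Qed.

Lemma eqvb_trans : transitive eqvb.
Proof.
by move=> y x z /asboolP xy /asboolP yz; apply/asboolP; exact: eqv_trans xy yz.
Qed.

Canonical eqvb_equiv := EquivRel eqvb eqvb_refl eqvb_sym eqvb_trans.

Definition functional := {eq_quot eqvb}.
HB.instance Definition _ : EqQuotient _ eqvb functional :=
  EqQuotient.on functional.
HB.instance Definition _ := Choice.on functional.

Definition cls (x : expr) : functional := \pi_functional (x : {classic expr}).

Lemma clsP (x y : expr) : cls x = cls y <-> eqv x y.
Proof.
split=> [/eqP|xy]; rewrite /cls; first by rewrite piE => /asboolP.
by apply/eqP; rewrite piE; apply/asboolP.
Qed.

Definition rep (F : functional) : expr := repr F.

Lemma repK F : cls (rep F) = F.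
Proof. by rewrite /cls /rep reprK. Qed.

Lemma rep_cls x : eqv (rep (cls x)) x.
Proof. by apply/clsP; rewrite repK. Qed.

Definition fadd (F G : functional) := cls (Add (rep F) (rep G)).
Definition fmul (F G : functional) := cls (Mul (rep F) (rep G)).
Definition fopp (F : functional) := cls (Mul (Fun (-1)) (rep F)).
Definition fpartial mu (F : functional) := cls (Der mu (rep F)).
Definition fscale (p : O) (F : functional) := cls (Mul (Fun p) (rep F)).

Lemma faddE x y : fadd (cls x) (cls y) = cls (Add x y).
Proof. by apply/clsP/eqv_add; exact: rep_cls. Qed.

Lemma fmulE x y : fmul (cls x) (cls y) = cls (Mul x y).
Proof. by apply/clsP/eqv_mul; exact: rep_cls. Qed.

Lemma foppE x : fopp (cls x) = cls (Mul (Fun (-1)) x).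
Proof. by apply/clsP/eqv_mul; [exact: eqv_refl|exact: rep_cls]. Qed.

Lemma fscaleE p x : fscale p (cls x) = cls (Mul (Fun p) x).
Proof. by apply/clsP/eqv_mul; [exact: eqv_refl|exact: rep_cls]. Qed.

Lemma fpartialE mu x : fpartial mu (cls x) = cls (Der mu x).
Proof. by apply/clsP/eqv_der; exact: rep_cls. Qed.

Lemma faddA : associative fadd.
Proof.
move=> F G H; rewrite -[F]repK -[G]repK -[H]repK !faddE.
by apply/clsP; exact: eqv_addA.
Qed.

Lemma faddC : commutative fadd.
Proof.
by move=> F G; rewrite -[F]repK -[G]repK !faddE; apply/clsP; exact: eqv_addC.
Qed.

Lemma fadd0 : left_id (cls (Fun 0)) fadd.
Proof. by move=> F; rewrite -[F]repK faddE; apply/clsP; exact: eqv_add0. Qed.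

Lemma faddN : left_inverse (cls (Fun 0)) fopp fadd.
Proof.
move=> F; rewrite -[F]repK foppE faddE; apply/clsP.
apply: eqv_trans (eqv_mul0 (rep F)); rewrite -[in Fun 0](addNr (1 : O)).
apply: eqv_sym; apply: eqv_trans (eqv_mul (eqv_funD _ _) (eqv_refl _)) _.
apply: eqv_trans (eqv_mulDl _ _ _) _.
by apply: eqv_add; [exact: eqv_refl|exact: eqv_mul1].
Qed.

HB.instance Definition _ :=
  GRing.isZmodule.Build functional faddA faddC fadd0 faddN.

Lemma fmulA : associative fmul.
Proof.
move=> F G H; rewrite -[F]repK -[G]repK -[H]repK !fmulE.
by apply/clsP; exact: eqv_mulA.
Qed.

Lemma fmul1 : left_id (cls (Fun 1)) fmul.
Proof. by move=> F; rewrite -[F]repK fmulE; apply/clsP; exact: eqv_mul1. Qed.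

Lemma fmulr1 : right_id (cls (Fun 1)) fmul.
Proof.
move=> F; rewrite -[F]repK fmulE; apply/clsP.
exact: eqv_trans (eqv_sym (eqv_funC _ _)) (eqv_mul1 _).
Qed.

Lemma fmulDl : left_distributive fmul fadd.
Proof.
move=> F G H; rewrite -[F]repK -[G]repK -[H]repK !(fmulE, faddE).
by apply/clsP; exact: eqv_mulDl.
Qed.

Lemma fmulDr : right_distributive fmul fadd.
Proof.
move=> F G H; rewrite -[F]repK -[G]repK -[H]repK !(fmulE, faddE).
by apply/clsP; exact: eqv_mulDr.
Qed.

(* Evaluation at the flat background with all other fields 0, used to see
   that the algebra is not trivial. *)
Fixpoint eval_flat (x : expr) : O :=
  match x with
  | Fun p => p
  | Var phi => match phi with
               | InvMetric mu nu => minkowski O mu nu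
               | Vielbein m mu => (m == mu)%:R
               | _ => 0
               end
  | Add x y => eval_flat x + eval_flat y
  | Mul x y => eval_flat x * eval_flat y
  | Der mu x => coord_pd O mu (eval_flat x)
  end.

Lemma parityD (s s' : int * int) :
  parity (s.1 + s'.1, s.2 + s'.2) = parity s (+) parity s'.
Proof.
have oddD (m n : int) : odd (absz (m + n)) = odd (absz m) (+) odd (absz n).
  have sgn (k : int) : (-1 : int) ^+ odd (absz k) = (-1) ^ k.
    by rewrite signr_odd; case: k => // k; rewrite NegzE exprN invr_sign.
  by apply: (@signr_inj int); rewrite signr_addb !sgn exprzDr.
by rewrite /parity /= addrACA [LHS]oddD.
Qed.

Lemma eval_flat_hom s x : expr_hom s x -> parity s -> eval_flat x = 0.
Proof.
elim=> //=.
- by case.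
- by move=> {}s x1 y _ IHx _ IHy ps; rewrite IHx // IHy // addr0.
- move=> {}s s' x1 y _ IHx _ IHy; rewrite parityD.
  by case: (parity s) IHx => [/(_ isT)->|_ /= /IHy ->]; rewrite ?mul0r ?mulr0.
- by move=> {}s mu x1 _ IHx ps; rewrite IHx // linear0.
Qed.

Lemma eval_flat_big n (F : 'I_n -> expr) :
  eval_flat (\big[Add/Fun 0]_(i < n) F i) = \sum_(i < n) eval_flat (F i).
Proof. exact: (big_morph eval_flat). Qed.

Lemma eval_flat_eqv x y : eqv x y -> eval_flat x = eval_flat y.
Proof.
elim=> //=.
- by move=> x1 y1 z _ -> _ ->.
- by move=> x1 x' y1 y' _ -> _ ->.
- by move=> x1 x' y1 y' _ -> _ ->.
- by move=> mu x1 x' _ ->.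
- by move=> x1 y1; rewrite addrC.
- by move=> x1 y1 z; rewrite addrA.
- by move=> x1; rewrite add0r.
- by move=> x1 y1 z; rewrite mulrA.
- by move=> x1 y1 z; rewrite mulrDl.
- by move=> x1 y1 z; rewrite mulrDr.
- by move=> x1; rewrite mul1r.
- by move=> x1; rewrite mul0r.
- by move=> p x1; rewrite mulrC.
- by move=> mu x1 y1; rewrite linearD.
- by move=> mu x1 y1; rewrite coord_pdM.
- by move=> mu nu x1; rewrite coord_pdC.
- move=> s s' x1 y1 hx hy; have := eval_flat_hom hx; have := eval_flat_hom hy.
  case: (parity s) => [_ /(_ isT)->|_ _] /=; first by rewrite !(mul0r, mulr0).
  by rewrite mul1r mulrC.
- by move=> mu nu; rewrite /minkowski eq_sym; case: eqP => // ->.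
- move=> rho nu; rewrite eval_flat_big /= /minkowski (bigD1 rho) //= eqxx.
  rewrite big1 ?addr0 => [|i /negPf]; last by rewrite eq_sym => ->; rewrite mul0r.
  rewrite mulr0 addr0; case: (rho == nu); last by rewrite mulr0.
  by case: ifP => _; rewrite ?mulr1 ?mulrNN ?mulr1.
- move=> mu nu; rewrite eval_flat_big /= (bigD1 mu) //= eval_flat_big /=.
  rewrite (bigD1 nu) //= !eqxx !mulr1 big1 => [|n /negPf ->]; last first.
    by rewrite !mulr0.
  rewrite big1 => [|m /negPf mmu]; last first.
    by rewrite eval_flat_big big1 // => n _ /=; rewrite mmu mul0r mulr0.
  by rewrite !mulr0 !addr0.
Qed.

Lemma fone_neq0 : cls (Fun 1) != 0.
Proof.
by apply/eqP => /clsP/eval_flat_eqv/eqP; rewrite oner_eq0.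
Qed.

HB.instance Definition _ := GRing.Zmodule_isNzRing.Build functional
  fmulA fmul1 fmulr1 fmulDl fmulDr fone_neq0.

Lemma fscaleA p q F : fscale p (fscale q F) = fscale (p * q) F.
Proof.
rewrite -[F]repK !fscaleE; apply/clsP; apply: eqv_trans (eqv_mulA _ _ _) _.
by apply: eqv_mul; [apply/eqv_sym/eqv_funM|exact: eqv_refl].
Qed.

Lemma fscale1 : left_id 1 fscale.
Proof. by move=> F; rewrite -[F]repK fscaleE; apply/clsP/eqv_mul1. Qed.

Lemma fscaleDr : right_distributive fscale fadd.
Proof.
move=> p F G; rewrite -[F]repK -[G]repK !(fscaleE, faddE).
by apply/clsP; exact: eqv_mulDr.
Qed.

Lemma fscaleDl F p q : fscale (p + q) F = fadd (fscale p F) (fscale q F).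
Proof.
rewrite -[F]repK !(fscaleE, faddE); apply/clsP.
exact: eqv_trans (eqv_mul (eqv_funD _ _) (eqv_refl _)) (eqv_mulDl _ _ _).
Qed.

HB.instance Definition _ := GRing.Zmodule_isLmodule.Build O functional
  fscaleA fscale1 fscaleDr fscaleDl.

Lemma fscaleAl p F G : fscale p (fmul F G) = fmul (fscale p F) G.
Proof.
rewrite -[F]repK -[G]repK !(fscaleE, fmulE); apply/clsP; exact: eqv_mulA.
Qed.

Lemma fscaleAr p F G : fscale p (fmul F G) = fmul F (fscale p G).
Proof.
rewrite -[F]repK -[G]repK !(fscaleE, fmulE); apply/clsP.
apply: eqv_trans (eqv_mulA _ _ _) _.
apply: eqv_trans (eqv_mul (eqv_funC _ _) (eqv_refl _)) _.
exact/eqv_sym/eqv_mulA.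
Qed.

HB.instance Definition _ := GRing.Lmodule_isLalgebra.Build O functional fscaleAl.
HB.instance Definition _ := GRing.Lalgebra_isAlgebra.Build O functional fscaleAr.

Definition fvar (phi : field d nG nH nS) : functional := cls (Var phi).

Definition homogeneous (s : int * int) (F : functional) : Prop :=
  exists2 x, expr_hom s x & F = cls x.

Definition hh mu nu := fvar (Graviton mu nu).
Definition ginv rho sigma := fvar (InvMetric rho sigma).
Definition ee m mu := fvar (Vielbein m mu).
Definition AA a mu := fvar (GaugeBoson a mu).
Definition HPhi i := fvar (Higgs i).
Definition FPsi i := fvar (Fermion i).
Definition BB rho := fvar (GravAux rho).
Definition bb a := fvar (GaugeAux a).
Definition CC rho := fvar (GravGhost rho).
Definition CCbar rho := fvar (GravAntighost rho).
Definition cc a := fvar (GaugeGhost a).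
Definition ccbar a := fvar (GaugeAntighost a).

Definition eta (mu nu : 'I_d.+1) : functional := (minkowski O mu nu)%:A.
Definition kronecker (a b : 'I_nG) : functional := ((a == b)%:R : O)%:A.
Definition metric mu nu : functional := eta mu nu + rscal kappa *: hh mu nu.

Definition christoffel rho mu nu : functional :=
  \sum_(sigma < d.+1) rscal (2^-1) *:
    (ginv rho sigma * (fpartial mu (metric nu sigma)
                       + fpartial nu (metric mu sigma)
                       - fpartial sigma (metric mu nu))).

(* Vector fields on the bundle are vertical, hence linear over the functions
   on spacetime. *)
Record super_vector_field (i j : int) := SuperVectorField {
  svf :> {linear functional -> functional};
  svf_homogeneous : forall s F, homogeneous s F ->
    homogeneous (s.1 + i, s.2 + j) (svf F);
  svf_leibniz : forall s F G, homogeneous s F ->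
    svf (F * G) =
      svf F * G + (-1) ^+ (parity (i, j) && parity s) * (F * svf G) }.

Definition supercommutator i j i' j' (X1 : super_vector_field i j)
    (X2 : super_vector_field i' j') (F : functional) : functional :=
  X1 (X2 F) - (-1) ^+ (parity (i, j) && parity (i', j')) * X2 (X1 F).

(* [deg] selects the degree with respect to which X is cohomological. *)
Definition cohomological (deg : int * int -> int) i j
    (X : super_vector_field i j) : Prop :=
  [/\ parity (i, j), deg (i, j) = 1
    & forall F, supercommutator X X F = X (X F) *+ 2 /\ X (X F) *+ 2 = 0].

End Functionals.

Arguments hh {R d O nG nH nS kappa}.
Arguments ginv {R d O nG nH nS kappa}.
Arguments ee {R d O nG nH nS kappa}.
Arguments AA {R d O nG nH nS kappa}.
Arguments HPhi {R d O nG nH nS kappa}.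
Arguments FPsi {R d O nG nH nS kappa}.
Arguments BB {R d O nG nH nS kappa}.
Arguments bb {R d O nG nH nS kappa}.
Arguments CC {R d O nG nH nS kappa}.
Arguments CCbar {R d O nG nH nS kappa}.
Arguments cc {R d O nG nH nS kappa}.
Arguments ccbar {R d O nG nH nS kappa}.
Arguments eta {R d O nG nH nS kappa}.
Arguments kronecker {R d O nG nH nS kappa}.
Arguments metric {R d O nG nH nS kappa}.
Arguments christoffel {R d O nG nH nS kappa}.
Arguments fvar {R d O nG nH nS kappa}.
Arguments super_vector_field {R d} O nG nH nS kappa i j.

Record is_gauge_BRST (R : realType) (d : nat) (O : coord_algebra R d)
    (gg : vectType R) (br : gg -> gg -> gg) (nG : nat) (t : nG.-tuple gg)
    (nH nS : nat) (HH : gg -> 'M[R[i]]_nH) (SS : gg -> 'M[R[i]]_nS)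
    (kappa g xi : R) (Q : super_vector_field O nG nH nS kappa 0 1) : Prop :=
  IsGaugeBRST {
    brst_partial : forall mu F, Q (fpartial mu F) = fpartial mu (Q F);
    brst_A : forall a mu, Q (AA a mu) =
      rscal O xi^-1 *: fpartial mu (cc a)
      + \sum_(b < nG) \sum_(c < nG)
          rscal O (g * struct_const br t a b c) *:
            (cc b * AA c mu);
    brst_c : forall a, Q (cc a) =
      \sum_(b < nG) \sum_(c < nG)
          rscal O (g / 2 * struct_const br t a b c) *:
            (cc b * cc c);
    brst_cbar : forall a, Q (ccbar a) = rscal O xi^-1 *: bb a;
    brst_b : forall a, Q (bb a) = 0;
    brst_delta : forall a b, Q (kronecker a b) = 0;
    brst_h : forall mu nu, Q (hh mu nu) = 0;
    brst_C : forall rho, Q (CC rho) = 0;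
    brst_Cbar : forall rho, Q (CCbar rho) = 0;
    brst_B : forall rho, Q (BB rho) = 0;
    brst_eta : forall mu nu, Q (eta mu nu) = 0;
    brst_Gamma : forall rho mu nu, Q (christoffel rho mu nu) = 0;
    (* the vielbein only depends on the metric *)
    brst_e : forall m mu, Q (ee m mu) = 0;
    brst_Phi : forall i, Q (HPhi i) =
      \sum_(a < nG) rscal O g *:
        (cc a * \sum_(j < nH) scal O (HH t`_a i j) *: HPhi j);
    brst_Psi : forall i, Q (FPsi i) =
      \sum_(a < nG) rscal O g *:
        (cc a * \sum_(j < nS) scal O (SS t`_a i j) *: FPsi j)
  }.

(* Odd components prescribed on the fields, and vanishing on the metric data,
   extend to a super vector field of bidegree (0, 1) commuting with the
   derivatives. *)
Section Existence.
Variables (R : realType) (d : nat) (O : coord_algebra R d) (nG nH nS : nat).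
Variable kappa : R.
Notation A := (functional O nG nH nS kappa).
Notation E := (expr O nG nH nS).
Implicit Types (x y : E) (F G : A) (s : int * int).
Notation cl := (@cls R d O nG nH nS kappa).

Lemma clsD x y : cl (Add x y) = cl x + cl y.
Proof. by rewrite -faddE. Qed.

Lemma clsM x y : cl (Mul x y) = cl x * cl y.
Proof. by rewrite -fmulE. Qed.

Lemma clsZ p x : p *: cl x = cl (Mul (Fun _ _ _ p) x).
Proof. by rewrite -fscaleE. Qed.

Lemma clsF p : cl (Fun _ _ _ p) = p%:A.
Proof.
rewrite clsZ; apply/clsP; apply: eqv_sym.
exact: eqv_trans (eqv_sym (eqv_funC _ _ _)) (eqv_mul1 _ _).
Qed.

Lemma cls_big n (F : 'I_n -> E) :
  cl (\big[@Add _ _ _ _ _ _/Fun _ _ _ 0]_(i < n) F i) = \sum_(i < n) cl (F i).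
Proof. by apply: (big_morph cl clsD); rewrite clsF scale0r. Qed.

Lemma fpartialD mu F G : fpartial mu (F + G) = fpartial mu F + fpartial mu G.
Proof.
rewrite -[F]repK -[G]repK -clsD !fpartialE -clsD; apply/clsP.
exact: eqv_derD.
Qed.

Lemma fpartialM mu F G :
  fpartial mu (F * G) = fpartial mu F * G + F * fpartial mu G.
Proof.
rewrite -[F]repK -[G]repK -clsM !fpartialE -!clsM -clsD; apply/clsP.
exact: eqv_derM.
Qed.

Lemma fpartialC mu nu F :
  fpartial mu (fpartial nu F) = fpartial nu (fpartial mu F).
Proof. by rewrite -[F]repK !fpartialE; apply/clsP/eqv_derC. Qed.

Lemma fpartialA mu (p : O) : fpartial mu (p%:A : A) = (coord_pd O mu p)%:A.
Proof. by rewrite -!clsF fpartialE; apply/clsP/eqv_der_fun. Qed.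

Lemma homogeneous0 s : homogeneous s (0 : A).
Proof. by exists (Fun _ _ _ 0); [exact: hom_zero|rewrite clsF scale0r]. Qed.

Lemma homogeneousA (p : O) : homogeneous (0, 0) (p%:A : A).
Proof. by exists (Fun _ _ _ p); [exact: hom_fun|rewrite clsF]. Qed.

Lemma homogeneous_var phi :
  homogeneous (field_bideg phi) (fvar phi : A).
Proof. by exists (Var _ phi); first exact: hom_var. Qed.

Lemma homogeneousD s F G :
  homogeneous s F -> homogeneous s G -> homogeneous s (F + G).
Proof.
move=> [x hx ->] [y hy ->]; exists (Add x y); first exact: hom_add.
by rewrite clsD.
Qed.

Lemma homogeneousM s s' F G : homogeneous s F -> homogeneous s' G ->
  homogeneous (s.1 + s'.1, s.2 + s'.2) (F * G).
Proof.
move=> [x hx ->] [y hy ->]; exists (Mul x y); first exact: hom_mul.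
by rewrite clsM.
Qed.

Lemma homogeneousZ s p F : homogeneous s F -> homogeneous s (p *: F).
Proof.
move=> hF; have := homogeneousM (homogeneousA p) hF.
by rewrite -scalerAl mul1r /= !add0r -surjective_pairing.
Qed.

Lemma homogeneous_sum s n (F : 'I_n -> A) :
  (forall i, homogeneous s (F i)) -> homogeneous s (\sum_(i < n) F i).
Proof.
move=> hF; elim/big_ind: _ => //; first exact: homogeneous0.
exact: homogeneousD.
Qed.

Lemma homogeneous_partial s mu F :
  homogeneous s F -> homogeneous s (fpartial mu F).
Proof.
by move=> [x hx ->]; exists (Der mu x); [exact: hom_der|rewrite fpartialE].
Qed.

Lemma fswap s s' F G : homogeneous s F -> homogeneous s' G ->
  F * G = (-1) ^+ (parity s && parity s') * (G * F).
Proof.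
move=> [x hx ->] [y hy ->]; rewrite -!clsM.
have -> : (-1) ^+ (parity s && parity s')
    = cl (Fun _ _ _ ((-1) ^+ (parity s && parity s'))).
  by rewrite clsF; case: (_ && _); rewrite ?expr0 ?expr1 ?scaleN1r ?scale1r.
by rewrite -clsM; apply/clsP; exact: eqv_swap.
Qed.

Variables (v : field d nG nH nS -> A).
Hypothesis v_hom : forall phi,
  homogeneous ((field_bideg phi).1, (field_bideg phi).2 + 1) (v phi).
Hypothesis v_graviton : forall mu nu, v (Graviton mu nu) = 0.
Hypothesis v_invmetric : forall mu nu, v (InvMetric mu nu) = 0.
Hypothesis v_vielbein : forall mu nu, v (Vielbein mu nu) = 0.

Fixpoint invol x : A :=
  match x with
  | Fun p => p%:A
  | Var phi => (-1) ^+ parity (field_bideg phi) * fvar phi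
  | Add x y => invol x + invol y
  | Mul x y => invol x * invol y
  | Der mu x => fpartial mu (invol x)
  end.

Fixpoint odd_der x : A :=
  match x with
  | Fun p => 0
  | Var phi => v phi
  | Add x y => odd_der x + odd_der y
  | Mul x y => odd_der x * cl y + invol x * odd_der y
  | Der mu x => fpartial mu (odd_der x)
  end.

Lemma fpartial0 mu : fpartial mu (0 : A) = 0.
Proof. by apply: (addrI (fpartial mu 0)); rewrite -fpartialD !addr0. Qed.

Lemma fpartialN mu F : fpartial mu (- F) = - fpartial mu F.
Proof. by apply: (addrI (fpartial mu F)); rewrite -fpartialD !addrN fpartial0. Qed.

Lemma signM (b : bool) F G : F * ((-1) ^+ b * G) = (-1) ^+ b * (F * G).
Proof. by case: b; rewrite ?expr0 ?mul1r // expr1 !mulN1r mulrN. Qed.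

Lemma fpartial_sign (b : bool) mu F :
  fpartial mu ((-1) ^+ b * F) = (-1) ^+ b * fpartial mu F.
Proof. by case: b; rewrite ?expr0 ?mul1r // expr1 !mulN1r fpartialN. Qed.

Lemma homogeneous_sign s (b : bool) F :
  homogeneous s F -> homogeneous s ((-1) ^+ b * F).
Proof.
move=> hF; case: b; rewrite ?expr0 ?mul1r // expr1 mulN1r -scaleN1r.
exact: homogeneousZ.
Qed.

Lemma invol_hom s x : expr_hom s x -> invol x = (-1) ^+ parity s * cl x.
Proof.
elim=> /=.
- by move=> s0; rewrite clsF scale0r mulr0.
- by move=> p; rewrite clsF expr0 mul1r.
- by [].
- by move=> s0 x1 y _ -> _ ->; rewrite clsD mulrDr.
- move=> s0 s' x1 y _ -> _ ->; rewrite clsM parityD signr_addb.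
  by rewrite -!mulrA signM.
- by move=> s0 mu x1 _ ->; rewrite fpartial_sign fpartialE.
Qed.

Lemma odd_der_hom s x : expr_hom s x -> homogeneous (s.1, s.2 + 1) (odd_der x).
Proof.
elim=> /=.
- by move=> s0; exact: homogeneous0.
- by move=> p; exact: homogeneous0.
- by move=> phi; exact: v_hom.
- by move=> s0 x1 y _ hx _ hy; exact: homogeneousD.
- move=> s0 s' x1 y hx ihx hy ihy; apply: homogeneousD.
    have hy' : homogeneous s' (cl y) by exists y.
    by have := homogeneousM ihx hy'; rewrite /= addrAC.
  have hx' : homogeneous s0 (cl x1) by exists x1.
  rewrite (invol_hom hx) -mulrA; apply: homogeneous_sign.
  by have := homogeneousM hx' ihy; rewrite /= addrA.
- by move=> s0 mu x1 _ h; exact: homogeneous_partial.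
Qed.

Notation bigE F := (\big[@Add R d O nG nH nS/Fun nG nH nS 0]_(i < _) F i).

Lemma invol_big n (F : 'I_n -> E) : invol (bigE F) = \sum_(i < n) invol (F i).
Proof. by apply: (big_morph invol) => //=; rewrite scale0r. Qed.

Lemma odd_der_big n (F : 'I_n -> E) :
  odd_der (bigE F) = \sum_(i < n) odd_der (F i).
Proof. exact: (big_morph odd_der). Qed.

Lemma invol_eqv x y : eqv kappa x y -> invol x = invol y.
Proof.
elim=> /=.
- by [].
- by [].
- by move=> x1 y1 z _ -> _ ->.
- by move=> x1 x' y1 y' _ -> _ ->.
- by move=> x1 x' y1 y' _ -> _ ->.
- by move=> mu x1 x' _ ->.
- by move=> x1 y1; rewrite addrC.
- by move=> x1 y1 z; rewrite addrA.
- by move=> x1; rewrite scale0r add0r.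
- by move=> x1 y1 z; rewrite mulrA.
- by move=> x1 y1 z; rewrite mulrDl.
- by move=> x1 y1 z; rewrite mulrDr.
- by move=> x1; rewrite scale1r mul1r.
- by move=> x1; rewrite scale0r mul0r.
- by move=> p x1; rewrite -scalerAl -scalerAr mul1r mulr1.
- by move=> p q; rewrite scalerDl.
- by move=> p q; rewrite -scalerAl mul1r scalerA.
- by move=> mu x1 y1; rewrite fpartialD.
- by move=> mu x1 y1; rewrite fpartialM.
- by move=> mu nu x1; rewrite fpartialC.
- by move=> mu p; rewrite fpartialA.
- move=> s s' x1 y1 hx hy; rewrite (invol_hom hx) (invol_hom hy).
  have hx' : homogeneous s (cl x1) by exists x1.
  have hy' : homogeneous s' (cl y1) by exists y1.
  have := fswap hx' hy'; case: (parity s); case: (parity s') => /=;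
  by rewrite ?expr0 ?expr1 ?scale1r ?scaleN1r
    ?(mul1r, mulN1r, mulNr, mulrN, opprK) => ->.
- move=> mu nu; rewrite expr0 !mul1r; apply/clsP; exact: eqv_graviton.
- move=> mu nu; rewrite expr0 !mul1r; apply/clsP; exact: eqv_invmetric.
- move=> rho nu; rewrite -(@clsF (rho == nu)%:R).
  have /clsP <- := eqv_invmetricK O nG nH nS kappa rho nu.
  rewrite cls_big invol_big.
  by apply: eq_bigr => i _; rewrite /= !(clsM, clsD, clsF) !expr0 !mul1r.
- move=> mu nu; rewrite invol_big.
  have /clsP := eqv_vielbein O nG nH nS kappa mu nu.
  rewrite !(clsM, clsD, clsF) cls_big !expr0 !mul1r => <-.
  apply: eq_bigr => m _.
  rewrite invol_big cls_big.
  by apply: eq_bigr => n _; rewrite /= !(clsM, clsF) !expr0 !mul1r.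
Qed.

Lemma odd_der_eqv x y : eqv kappa x y -> odd_der x = odd_der y.
Proof.
elim=> /=.
- by [].
- by [].
- by move=> x1 y1 z _ -> _ ->.
- by move=> x1 x' y1 y' _ -> _ ->.
- by move=> x1 x' y1 y' ex -> /clsP-> ->; rewrite (invol_eqv ex).
- by move=> mu x1 x' _ ->.
- by move=> x1 y1; rewrite addrC.
- by move=> x1 y1 z; rewrite addrA.
- by move=> x1; rewrite add0r.
- by move=> x1 y1 z; rewrite clsM mulrDl mulrDr !mulrA addrA.
- by move=> x1 y1 z; rewrite !mulrDl addrACA.
- by move=> x1 y1 z; rewrite clsD !mulrDr addrACA.
- by move=> x1; rewrite mul0r add0r scale1r mul1r.
- by move=> x1; rewrite !(mul0r, scale0r) addr0.
- by move=> p x1; rewrite clsF mul0r add0r mulr0 addr0 -scalerAl -scalerAr mul1r mulr1.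
- by move=> p q; rewrite addr0.
- by move=> p q; rewrite mul0r mulr0 addr0.
- by move=> mu x1 y1; rewrite fpartialD.
- move=> mu x1 y1; rewrite fpartialD !fpartialM -!fpartialE.
  by rewrite -!addrA; congr (_ + _); rewrite addrCA.
- by move=> mu nu x1; rewrite fpartialC.
- by move=> mu p; rewrite fpartial0.
- move=> s s' x1 y1 hx hy; rewrite mul0r add0r.
  have hx' : homogeneous s (cl x1) by exists x1.
  have hy' : homogeneous s' (cl y1) by exists y1.
  rewrite (invol_hom hx) (invol_hom hy).
  have E s0 : parity (s0.1, s0.2 + 1) = ~~ parity s0.
    by have := parityD s0 (0, 1); rewrite /= addr0 addbT.
  have := fswap (odd_der_hom hx) hy'; have := fswap hx' (odd_der_hom hy).
  rewrite !E; case: (parity s); case: (parity s') => /=;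
  by rewrite ?expr0 ?expr1 ?scale1r ?scaleN1r
    ?(mul1r, mulN1r, mulNr, mulrN, opprK, opprD) => -> ->; rewrite addrC ?opprK.
- by move=> mu nu; rewrite !v_graviton.
- by move=> mu nu; rewrite !v_invmetric.
- move=> rho nu; rewrite odd_der_big.
  apply: big1 => i _ /=; rewrite v_invmetric v_graviton.
  by rewrite !(mul0r, mulr0, addr0).
- move=> mu nu; rewrite odd_der_big v_graviton.
  rewrite big1 => [|m _]; first by rewrite !(mul0r, mulr0, addr0).
  rewrite odd_der_big big1 // => n _ /=.
  by rewrite !v_vielbein !(mul0r, mulr0, addr0).
Qed.

Definition odd_vf (F : A) : A := odd_der (rep F).

Lemma odd_vfE x : odd_vf (cl x) = odd_der x.
Proof. exact/odd_der_eqv/rep_cls. Qed.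

Lemma odd_vf_linear : linear odd_vf.
Proof.
move=> p F G; rewrite -[F]repK -[G]repK clsZ -clsD !odd_vfE /=.
by rewrite mul0r add0r -scalerAl mul1r.
Qed.

HB.instance Definition _ := GRing.isLinear.Build O A A _ odd_vf odd_vf_linear.

Lemma odd_vf_homogeneous s F :
  homogeneous s F -> homogeneous (s.1 + 0, s.2 + 1) (odd_vf F).
Proof. by move=> [x hx ->]; rewrite odd_vfE addr0; exact: odd_der_hom. Qed.

Lemma odd_vf_leibniz s F G : homogeneous s F ->
  odd_vf (F * G) = odd_vf F * G
                   + (-1) ^+ (parity (0, 1) && parity s) * (F * odd_vf G).
Proof.
move=> [x hx ->]; rewrite -[G]repK -clsM !odd_vfE /=.
by rewrite (invol_hom hx) mulrA.
Qed.

Definition odd_svf : super_vector_field O nG nH nS kappa 0 1 :=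
  SuperVectorField odd_vf_homogeneous odd_vf_leibniz.

Lemma odd_svf_var phi : odd_svf (fvar phi) = v phi.
Proof. exact: odd_vfE. Qed.

Lemma odd_svf_partial mu F : odd_svf (fpartial mu F) = fpartial mu (odd_svf F).
Proof. by rewrite -[F]repK fpartialE /= !odd_vfE. Qed.

Lemma odd_svfA (p : O) : odd_svf p%:A = 0.
Proof. by rewrite -clsF /= odd_vfE. Qed.

Lemma odd_svf_christoffel rho mu nu : odd_svf (christoffel rho mu nu) = 0.
Proof.
have Qm mu' nu' : odd_svf (metric mu' nu') = 0.
  rewrite linearD [X in X + _]odd_svfA linearZ [odd_svf _]odd_svf_var v_graviton.
  by rewrite add0r [LHS]scaler0.
rewrite linear_sum big1 // => sigma _; rewrite linearZ.
rewrite (svf_leibniz _ _ (homogeneous_var (InvMetric rho sigma))).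
rewrite odd_svf_var v_invmetric linearB linearD !odd_svf_partial !Qm.
rewrite !fpartial0 addr0 subr0.
by rewrite mul0r !mulr0 addr0; exact: scaler0.
Qed.

End Existence.

Lemma gauge_BRST_exists (R : realType) (d : nat) (O : coord_algebra R d)
    (gg : vectType R) (br : gg -> gg -> gg) (nG : nat) (t : nG.-tuple gg)
    (nH nS : nat) (HH : gg -> 'M[R[i]]_nH) (SS : gg -> 'M[R[i]]_nS)
    (kappa g xi : R) :
  exists Q : super_vector_field O nG nH nS kappa 0 1,
    is_gauge_BRST br t HH SS g xi Q.
Proof.
pose A := functional O nG nH nS kappa.
pose v (phi : field d nG nH nS) : A := match phi with
  | GaugeBoson a mu => rscal O xi^-1 *: fpartial mu (cc a)
      + \sum_(b < nG) \sum_(c < nG)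
          rscal O (g * struct_const br t a b c) *: (cc b * AA c mu)
  | GaugeGhost a => \sum_(b < nG) \sum_(c < nG)
          rscal O (g / 2 * struct_const br t a b c) *: (cc b * cc c)
  | GaugeAntighost a => rscal O xi^-1 *: bb a
  | Higgs i => \sum_(a < nG) rscal O g *:
        (cc a * \sum_(j < nH) scal O (HH t`_a i j) *: HPhi j)
  | Fermion i => \sum_(a < nG) rscal O g *:
        (cc a * \sum_(j < nS) scal O (SS t`_a i j) *: FPsi j)
  | _ => 0
  end.
have hc b : homogeneous (0, 1) (cc b : A) := homogeneous_var _ _ (GaugeGhost b).
have v_hom phi :
    homogeneous ((field_bideg phi).1, (field_bideg phi).2 + 1) (v phi).
  case: phi => *; rewrite ?/(field_bideg _) ?/(v _); try exact: homogeneous0.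
  - apply: homogeneousD.
      exact/homogeneousZ/homogeneous_partial/hc.
    do 2!apply: homogeneous_sum => ?; apply: homogeneousZ.
    exact: homogeneousM (hc _) (homogeneous_var _ _ (GaugeBoson _ _)).
  - apply: homogeneous_sum => ?; apply: homogeneousZ.
    apply: (homogeneousM (s' := (0, 0)) (hc _)); apply: homogeneous_sum => ?.
    exact: homogeneousZ (homogeneous_var _ _ (Higgs _)).
  - apply: homogeneous_sum => ?; apply: homogeneousZ.
    apply: (homogeneousM (s' := (0, 0)) (hc _)); apply: homogeneous_sum => ?.
    exact: homogeneousZ (homogeneous_var _ _ (Fermion _)).
  - do 2!apply: homogeneous_sum => ?; apply: homogeneousZ.
    exact: homogeneousM (hc _) (hc _).
  - exact: homogeneousZ (homogeneous_var _ _ (GaugeAux _)).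
exists (odd_svf v_hom (fun _ _ => erefl) (fun _ _ => erefl) (fun _ _ => erefl)).
by split=> *; rewrite (odd_svf_var, odd_svf_partial, odd_svfA,
  odd_svf_christoffel).
Qed.

(* Main.v *)
(** The square of the odd superderivation Q is again a derivation and commutes
    with the coordinate derivatives, so it vanishes as soon as it does on the
    field components.  There the BRST operator acts as g times a representation
    of the gauge algebra contracted with the ghosts: on a matter field,
    Q^2 y is the curvature of the connection g c, which vanishes because c
    satisfies the Maurer-Cartan equation Qc = (g/2) [c, c].  The Higgs field and
    the fermions are matter; the gauge boson and the ghost are matter in the
    adjoint representation, up to the term in dc and the factor 1/2. *)

From HB Require Import structures.
Require Import Defs.
From mathcomp Require Import all_boot all_order all_algebra.
From mathcomp Require Import boolp reals.
From mathcomp Require Import complex.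
From mathcomp Require Import ring.

Set Implicit Arguments.
Unset Strict Implicit.
Unset Printing Implicit Defensive.

Import Order.TTheory GRing.Theory Num.Theory.
Local Open Scope ring_scope.

(** * Quadratic expressions in anticommuting generators *)

Section Anticommuting.
Variables (K : comNzRingType) (A : algType K) (n : nat) (theta : 'I_n -> A).
Hypothesis thetaC : forall b c, theta b * theta c = - (theta c * theta b).

(** Renaming the indices in the second half pairs each term with its opposite. Writing the
    coefficient as a symmetrization avoids a division by 2. *)
Lemma sum_symmetric_anticommuting (N : 'I_n -> 'I_n -> K) :
  \sum_b \sum_c (N b c + N c b) *: (theta b * theta c) = 0.
Proof.
under eq_bigr do under eq_bigr do rewrite scalerDl.
under eq_bigr do rewrite big_split.
rewrite big_split /= [X in _ + X]exchange_big -big_split big1 // => b _.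
rewrite -big_split big1 // => c _ /=.
by rewrite [theta c * _]thetaC scalerN addrN.
Qed.

(* The curvature of the connection [g *: theta] vanishes when [theta] satisfies
   the Maurer-Cartan equation; [h] stands for g / 2. *)
Lemma covariant_square (f : 'I_n -> 'I_n -> 'I_n -> K) m
    (M : 'I_n -> 'M[K]_m) (y : 'I_m -> A) (g h : K) i :
  g = h + h ->
  (forall b c, M b *m M c - M c *m M b = \sum_a f a b c *: M a) ->
  \sum_a \sum_j (g * M a i j) *:
    ((\sum_b \sum_c (h * f a b c) *: (theta b * theta c)) * y j
     - theta a * \sum_b \sum_k (g * M b j k) *: (theta b * y k)) = 0.
Proof.
move=> gE MM.
(* Contracting [f] with the [M a] turns the Maurer-Cartan term into a commutator. *)
have E1 : \sum_a \sum_j (g * M a i j) *: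
    ((\sum_b \sum_c (h * f a b c) *: (theta b * theta c)) * y j)
  = \sum_j (\sum_b \sum_c (g * h * (M b *m M c - M c *m M b) i j)
      *: (theta b * theta c)) * y j.
  rewrite exchange_big; apply: eq_bigr => j _ /=.
  under [LHS]eq_bigr do rewrite scalerAl.
  rewrite -mulr_suml; congr (_ * _).
  under [LHS]eq_bigr do rewrite scaler_sumr.
  rewrite exchange_big; apply: eq_bigr => b _ /=.
  under [LHS]eq_bigr do rewrite scaler_sumr.
  rewrite exchange_big; apply: eq_bigr => c _ /=.
  rewrite MM summxE mulr_sumr scaler_suml; apply: eq_bigr => a _.
  by rewrite scalerA mxE mulrACA [f _ _ _ * _]mulrC.
have E2 : \sum_a \sum_j (g * M a i j) *:
    (theta a * \sum_b \sum_k (g * M b j k) *: (theta b * y k))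
  = \sum_j (\sum_b \sum_c (g * g * (M b *m M c) i j)
      *: (theta b * theta c)) * y j.
  under [RHS]eq_bigr do rewrite mulr_suml.
  rewrite [RHS]exchange_big; apply: eq_bigr => a _ /=.
  under [LHS]eq_bigr do rewrite mulr_sumr scaler_sumr.
  under [RHS]eq_bigr do rewrite mulr_suml.
  rewrite exchange_big [RHS]exchange_big; apply: eq_bigr => b _ /=.
  under [LHS]eq_bigr do rewrite mulr_sumr scaler_sumr.
  rewrite exchange_big; apply: eq_bigr => k _ /=.
  rewrite mxE mulr_sumr scaler_suml mulr_suml; apply: eq_bigr => j _.
  by rewrite -scalerAr scalerA -scalerAl mulrACA [theta a * (_ * _)]mulrA.
under eq_bigr do under eq_bigr do rewrite scalerBr.
under eq_bigr do rewrite sumrB.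
rewrite sumrB E1 E2 -sumrB big1 // => j _.
(* Since g = 2h, the coefficient gh [M_b, M_c] - g^2 M_b M_c equals -gh (M_b M_c + M_c M_b), which
   is symmetric in b and c. *)
pose N b c := - (g * h * (M b *m M c) i j).
rewrite -mulrBl -sumrB.
rewrite -[X in X * _](_ : \sum_b \sum_c (N b c + N c b) *: (theta b * theta c) = _);
  last first.
  apply: eq_bigr => b _; rewrite -sumrB; apply: eq_bigr => c _.
  by rewrite -scalerBl /N !mxE gE; congr (_ *: _); ring.
by rewrite sum_symmetric_anticommuting mul0r.
Qed.

End Anticommuting.

(** * Lie brackets and representations in a basis *)

Section StructureConstants.
Variables (R : realType) (gg : vectType R) (br : gg -> gg -> gg).
Hypothesis hbr : is_lie_bracket br.
Variables (n : nat) (t : n.-tuple gg).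
Hypothesis ht : basis_of fullv t.
Notation f := (struct_const br t).
Implicit Types (x y z : gg) (a b c : 'I_n).

Lemma lie_br0 z : br z 0 = 0.
Proof.
by have := lie_linearr hbr (-1) 0 0 z; rewrite !scaleN1r oppr0 addr0 addNr.
Qed.

Lemma lie_brN z x : br z (- x) = - br z x.
Proof.
by have := lie_linearr hbr (-1) x 0 z; rewrite !scaleN1r lie_br0 !addr0.
Qed.

Lemma lie_sumr z (k : 'I_n -> R) (x : 'I_n -> gg) :
  br z (\sum_a k a *: x a) = \sum_a k a *: br z (x a).
Proof.
elim/big_rec2: _ => [|a y1 y2 _ <-]; first exact: lie_br0.
exact: lie_linearr.
Qed.

Lemma lie_antisym x y : br x y = - br y x.
Proof.
have D1 u v w : br (u + v) w = br u w + br v w.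
  by have := lie_linearl hbr 1 u v w; rewrite !scale1r.
have D2 u v w : br w (u + v) = br w u + br w v.
  by have := lie_linearr hbr 1 u v w; rewrite !scale1r.
apply/eqP; rewrite -addr_eq0; apply/eqP.
have := lie_alt hbr (x + y).
by rewrite D1 !D2 !(lie_alt hbr) add0r addr0.
Qed.

Lemma struct_constE b c : br t`_b t`_c = \sum_a f a b c *: t`_a.
Proof. exact: coord_basis ht (memvf _). Qed.

Lemma struct_const_antisym a b c : f a b c = - f a c b.
Proof. by rewrite /struct_const lie_antisym linearN. Qed.

(** This is the Jacobi identity: [ad a] is the matrix of the bracket with the a-th basis vector, so
    matrix products are coordinates of iterated brackets. *)
Lemma adjoint_rep b c :
  let ad a : 'M[R]_n := \matrix_(i, j) f i a j in
  ad b *m ad c - ad c *m ad b = \sum_a f a b c *: ad a.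
Proof.
move=> ad; apply/matrixP => i j; rewrite !mxE summxE.
have E b' c' : \sum_e ad b' i e * ad c' e j = coord t i (br t`_b' (br t`_c' t`_j)).
  rewrite [br t`_c' _]struct_constE lie_sumr linear_sum.
  by apply: eq_bigr => e _; rewrite !mxE linearZ mulrC.
rewrite !E.
transitivity (coord t i (br (br t`_b t`_c) t`_j)); last first.
  rewrite lie_antisym struct_constE lie_sumr linearN linear_sum -sumrN.
  apply: eq_bigr => a _; rewrite !mxE linearZ /= -mulrN -linearN.
  by rewrite -lie_antisym; congr (_ * _).
rewrite -raddfB; congr (coord t i _).
have := lie_jacobi hbr t`_b t`_c t`_j.
rewrite [br t`_j t`_b]lie_antisym [br t`_j (br _ _)]lie_antisym lie_brN.
by move/eqP; rewrite subr_eq0 => /eqP.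
Qed.

Lemma lie_rep_struct_const N (rho : gg -> 'M[R[i]]_N) b c :
  is_lie_rep br rho ->
  rho t`_b *m rho t`_c - rho t`_c *m rho t`_b
  = \sum_a real_complex R (f a b c) *: rho t`_a.
Proof.
move=> hrho; rewrite -(lie_rep_bracket hrho) struct_constE.
have rho0 : rho 0 = 0.
  have := lie_rep_linear hrho (-1) 0 0.
  by rewrite scaleN1r oppr0 addr0 rmorphN rmorph1 scaleN1r addNr.
elim/big_rec2: _ => // a y1 y2 _ <-.
by rewrite (lie_rep_linear hrho).
Qed.

End StructureConstants.

(** * The square of an odd superderivation *)

Section SquareZero.
Variables (R : realType) (d : nat) (O : coord_algebra R d).
Variables (nG nH nS : nat) (kappa : R).
Notation A := (functional O nG nH nS kappa).
Variable Q : super_vector_field O nG nH nS kappa 0 1.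
Hypothesis Q_partial : forall mu F, Q (fpartial mu F) = fpartial mu (Q F).

Lemma svf1 : Q 1 = 0.
Proof.
have h1 : homogeneous (0, 0) (1 : A) by rewrite -[1]scale1r; exact: homogeneousA.
have := svf_leibniz Q 1 h1.
by rewrite /= expr0 !mulr1 !mul1r -{1}[Q 1]addr0 => /addrI.
Qed.

Lemma svfA (p : O) : Q p%:A = 0.
Proof. by rewrite linearZ /= svf1; exact: scaler0. Qed.

(** F and QF have opposite parities, so the two cross terms QF QG carry opposite signs and
    cancel. *)
Lemma svf_sq_leibniz s F G : homogeneous s F ->
  Q (Q (F * G)) = Q (Q F) * G + F * Q (Q G).
Proof.
move=> hF; rewrite (svf_leibniz Q G hF) linearD.
rewrite (svf_leibniz Q G (svf_homogeneous Q hF)) (parityD s (0, 1)).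
have -> : Q ((-1) ^+ (parity (0, 1) && parity s) * (F * Q G))
    = (-1) ^+ (parity (0, 1) && parity s) * Q (F * Q G).
  by case: (_ && _); rewrite ?expr0 ?mul1r // expr1 !mulN1r linearN.
rewrite (svf_leibniz Q (Q G) hF) /=.
case: (parity s); rewrite /= ?expr0 ?expr1 ?mul1r ?mulN1r ?opprD ?opprK ?addrA.
  by rewrite addrK.
by rewrite addrNK.
Qed.

(* Arbitrary functionals need not be homogeneous, so the induction does not go
   through the Leibniz rule but through linearity over the subalgebra of those
   [F] with [Q (Q (F * G)) = F * Q (Q G)]. *)
Lemma svf_sq_eq0 : (forall phi, Q (Q (fvar phi)) = 0) -> forall F, Q (Q F) = 0.
Proof.
move=> Qvar F; rewrite -[F]mulr1 -[F]repK.
suff -> x G : Q (Q (cls kappa x * G)) = cls kappa x * Q (Q G).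
  by rewrite svf1 linear0 mulr0.
elim: x G => [p|phi|x IHx y IHy|x IHx y IHy|mu x IHx] G.
- by rewrite clsF (svf_sq_leibniz _ (homogeneousA _ _ _ _ p)) svfA linear0 mul0r add0r.
- rewrite (svf_sq_leibniz _ (homogeneous_var _ _ phi)).
  by rewrite [Q (Q _)]Qvar mul0r add0r.
- by rewrite clsD !mulrDl !linearD /= IHx IHy.
- by rewrite clsM -!mulrA IHx IHy.
(* Leibniz moves the derivative off [x], so that the induction hypothesis applies to [H] and to its
   derivative. *)
have E H : fpartial mu (cls kappa x) * H
    = fpartial mu (cls kappa x * H) - cls kappa x * fpartial mu H.
  by rewrite fpartialM addrK.
by rewrite -fpartialE !E !linearB /= !Q_partial !IHx !Q_partial.
Qed.

End SquareZero.

(** * Constants as functions on spacetime, by ring morphisms *)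

Section ScalarMorphisms.
Variables (R : realType) (d : nat) (O : coord_algebra R d).

HB.instance Definition _ := GRing.RMorphism.copy (scal O) (in_alg O).
HB.instance Definition _ :=
  GRing.RMorphism.copy (rscal O) (in_alg O \o real_complex R).

End ScalarMorphisms.

(** * The inverse metric, and derivatives of sums and constant multiples *)

Section GaugeBRST.
Variables (R : realType) (d : nat) (O : coord_algebra R d).
Variables (nG nH nS : nat) (kappa : R).
Notation A := (functional O nG nH nS kappa).
Variable Q : super_vector_field O nG nH nS kappa 0 1.
Hypothesis Q_partial : forall mu F, Q (fpartial mu F) = fpartial mu (Q F).

Lemma metric_sym mu nu : metric mu nu = metric nu mu :> A.
Proof.
rewrite /metric /eta /minkowski eq_sym.
have -> : hh mu nu = hh nu mu :> A by apply/clsP; exact: eqv_graviton.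
by case: eqP => [->|].
Qed.

Lemma ginv_metric rho nu :
  \sum_(sigma < d.+1) ginv rho sigma * metric sigma nu
  = (rho == nu)%:R%:A :> A.
Proof.
rewrite -clsF.
have /clsP <- := eqv_invmetricK O nG nH nS kappa rho nu.
rewrite cls_big; apply: eq_bigr => sigma _.
by rewrite clsM clsD clsF -clsZ.
Qed.

(** Both matrices are symmetric with commuting entries of degree (0, 0), so the left inverse is also
    a right inverse. *)
Lemma metric_ginv sigma tau :
  \sum_(nu < d.+1) metric sigma nu * ginv nu tau
  = (tau == sigma)%:R%:A :> A.
Proof.
rewrite -ginv_metric; apply: eq_bigr => nu _.
have -> : ginv nu tau = ginv tau nu :> A by apply/clsP; exact: eqv_invmetric.
have hm : homogeneous (0, 0) (metric sigma nu : A).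
  apply: homogeneousD; first exact: homogeneousA.
  exact/homogeneousZ/(homogeneous_var _ _ (Graviton _ _)).
rewrite (fswap hm (homogeneous_var _ _ (InvMetric tau nu))) expr0 mul1r.
by rewrite metric_sym.
Qed.

(** [is_gauge_BRST] lists no value of Q on [ginv]; applying Q to g^{-1} g = 1 gives Q(g^{-1}) g = 0,
    and multiplying by g^{-1} on the right concludes. *)
Lemma svf_ginv :
  (forall mu nu, Q (hh mu nu) = 0) -> forall rho tau, Q (ginv rho tau) = 0.
Proof.
move=> Qh rho tau.
have Qm mu nu : Q (metric mu nu) = 0.
  by rewrite linearD /= svfA linearZ /= Qh add0r; exact: scaler0.
have E nu : \sum_(sigma < d.+1) Q (ginv rho sigma) * metric sigma nu = 0.
  rewrite -[RHS](svfA Q (rho == nu)%:R) -ginv_metric linear_sum.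
  apply: eq_bigr => sigma _ /=.
  rewrite (svf_leibniz Q _ (homogeneous_var _ _ (InvMetric rho sigma))).
  by rewrite Qm !mulr0 addr0.
transitivity (\sum_(nu < d.+1)
    (\sum_(sigma < d.+1) Q (ginv rho sigma) * metric sigma nu) * ginv nu tau).
  under eq_bigr do rewrite mulr_suml.
  rewrite exchange_big /=.
  under eq_bigr do under eq_bigr do rewrite -mulrA.
  under eq_bigr do rewrite -mulr_sumr metric_ginv.
  rewrite (bigD1 tau) //= eqxx big1 ?addr0 ?scale1r ?mulr1 // => sigma.
  by rewrite eq_sym => /negPf ->; rewrite scale0r mulr0.
by rewrite big1 // => nu _; rewrite E mul0r.
Qed.

Lemma fpartial_sum mu n (F : 'I_n -> A) :
  fpartial mu (\sum_i F i) = \sum_i fpartial mu (F i).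
Proof. exact: (big_morph _ (@fpartialD _ _ _ _ _ _ _ mu) (fpartial0 _ _ _ _ _ mu)). Qed.

(** Constants have zero derivative, because Leibniz on 1 = 1 * 1 forces the derivative of 1 to
    vanish. *)
Lemma fpartialZ mu (r : R) (F : A) :
  fpartial mu (rscal O r *: F) = rscal O r *: fpartial mu F.
Proof.
have pd1 : coord_pd O mu 1 = 0.
  have := coord_pdM mu (1 : O) 1.
  by rewrite !mulr1 mul1r -{1}[coord_pd O mu 1]addr0 => /addrI.
rewrite -mulr_algl fpartialM fpartialA linearZ /= pd1 scaler0 scale0r mul0r.
by rewrite add0r mulr_algl.
Qed.

(** * The square of Q on matter fields, ghosts and gauge bosons *)

Section GaugeSector.
Variables (gg : vectType R) (br : gg -> gg -> gg) (t : nG.-tuple gg) (g : R).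
Hypothesis hbr : is_lie_bracket br.
Hypothesis ht : basis_of fullv t.
Notation f := (struct_const br t).
Hypothesis Qc : forall a, Q (cc a) =
  \sum_(b < nG) \sum_(c < nG) rscal O (g / 2 * f a b c) *: (cc b * cc c).

Lemma ccC b c : cc b * cc c = - (cc c * cc b) :> A.
Proof.
rewrite (fswap (homogeneous_var _ _ (GaugeGhost b))
  (homogeneous_var _ _ (GaugeGhost c))).
by rewrite expr1 mulN1r.
Qed.

Lemma svf_ccM a F : Q (cc a * F) = Q (cc a) * F - cc a * Q F.
Proof.
rewrite (svf_leibniz Q F (homogeneous_var _ _ (GaugeGhost a))).
by rewrite expr1 mulN1r.
Qed.

(** The inner sum is written out instead of [Q (y j)], so that the identity also serves for ghosts
    and gauge bosons, on which Q differs from the matter action. *)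
Lemma matter_sq m (M : 'I_nG -> 'M[O]_m) (y : 'I_m -> A) i :
  (forall b c, M b *m M c - M c *m M b = \sum_a rscal O (f a b c) *: M a) ->
  \sum_a \sum_j (rscal O g * M a i j) *:
    (Q (cc a) * y j
     - cc a * \sum_b \sum_k (rscal O g * M b j k) *: (cc b * y k)) = 0.
Proof.
move=> MM; have := @covariant_square O A nG cc ccC (fun a b c => rscal O (f a b c))
  m M y (rscal O g) (rscal O (g / 2)) i _ MM.
rewrite -rmorphD -splitr => /(_ erefl) E; rewrite -[RHS]E.
apply: eq_bigr => a _; apply: eq_bigr => j _; rewrite Qc.
by under eq_bigr do under eq_bigr do rewrite rmorphM.
Qed.

Lemma svf_sq_matter m (M : 'I_nG -> 'M[O]_m) (y : 'I_m -> A) i :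
  (forall b c, M b *m M c - M c *m M b = \sum_a rscal O (f a b c) *: M a) ->
  (forall i, Q (y i) = \sum_a rscal O g *: (cc a * \sum_j M a i j *: y j)) ->
  Q (Q (y i)) = 0.
Proof.
move=> MM Qy.
have {}Qy i' : Q (y i') = \sum_a \sum_j (rscal O g * M a i' j) *: (cc a * y j).
  rewrite Qy; apply: eq_bigr => a _; rewrite mulr_sumr scaler_sumr.
  by apply: eq_bigr => j _; rewrite -scalerAr scalerA.
rewrite Qy -[RHS](matter_sq y i MM) linear_sum; apply: eq_bigr => a _.
rewrite linear_sum; apply: eq_bigr => j _.
by rewrite linearZ /= svf_ccM Qy.
Qed.

Let ad a : 'M[O]_nG := map_mx (rscal O) (\matrix_(i, j) f i a j).

Let adE a i j : ad a i j = rscal O (f i a j).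
Proof. by rewrite !mxE. Qed.

Let ad_rep b c :
  ad b *m ad c - ad c *m ad b = \sum_a rscal O (f a b c) *: ad a.
Proof.
rewrite -!map_mxM -map_mxB adjoint_rep // map_mx_sum.
by apply: eq_bigr => a _; rewrite map_mxZ.
Qed.

Lemma struct_const_swap (k : R) a (u : 'I_nG -> 'I_nG -> A) :
  \sum_b \sum_c rscal O (k * f a b c) *: u b c
  = - \sum_b \sum_c rscal O (k * f a b c) *: u c b.
Proof.
rewrite exchange_big -sumrN; apply: eq_bigr => b _ /=.
rewrite -sumrN; apply: eq_bigr => c _.
by rewrite struct_const_antisym // mulrN rmorphN scaleNr.
Qed.

Let gZ p (F : A) : rscal O (g * p) *: F = rscal O (g / 2 * p) *: F *+ 2.
Proof.
by rewrite [RHS]scalerMnl -rmorphMn -mulrnAl -[_ / _ *+ 2]mulr_natr divfK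
  ?pnatr_eq0.
Qed.

(* The covariant square above, with the ghosts as matter in the adjoint
   representation, only gives [Q (Q (cc a)) *+ 3 = 0]. *)
Lemma svf_sq_cc a : Q (Q (cc a)) = 0.
Proof.
pose X := \sum_b \sum_c rscal O (g / 2 * f a b c) *: (Q (cc b) * cc c).
pose Y := \sum_b \sum_c rscal O (g / 2 * f a b c) *: (cc b * Q (cc c)).
have QQ : Q (Q (cc a)) = X - Y.
  rewrite Qc linear_sum -sumrB; apply: eq_bigr => b _.
  rewrite linear_sum -sumrB; apply: eq_bigr => c _.
  by rewrite linearZ /= svf_ccM -scalerBr.
(* Q c has bidegree (0, 2), hence is even and commutes with c; the sign comes from the antisymmetry
   of [f]. *)
have XY : X = - Y.
  rewrite /X struct_const_swap; congr (- _).
  apply: eq_bigr => b _; apply: eq_bigr => c _; congr (_ *: _).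
  rewrite (fswap (svf_homogeneous Q (homogeneous_var _ _ (GaugeGhost c)))
    (homogeneous_var _ _ (GaugeGhost b))).
  by rewrite expr0 mul1r.
(* On ghosts the adjoint matter action is 2 Qc, so [matter_sq] reads 2X - 4Y = 0. *)
have E : X *+ 2 - Y *+ 4 = 0.
  rewrite -[RHS](matter_sq cc a ad_rep) /X /Y -!sumrMnl -sumrB.
  apply: eq_bigr => b _; rewrite -!sumrMnl -sumrB; apply: eq_bigr => c _.
  rewrite adE -rmorphM /= gZ scalerBr mulrnBl.
  have -> : \sum_d \sum_k (rscal O g * ad d c k) *: (cc d * cc k)
      = Q (cc c) *+ 2 :> A.
    rewrite Qc -sumrMnl; apply: eq_bigr => d' _.
    rewrite -sumrMnl; apply: eq_bigr => k _.
    by rewrite adE -rmorphM /= gZ.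
  by rewrite mulrnAr -scalerMnr -mulrnA.
(* With X = -Y, both 2X - 4Y and 3 (X - Y) equal -6Y. *)
have /(congr1 (fun F => rscal O 3^-1 *: F)) : Q (Q (cc a)) *+ 3 = 0.
  rewrite QQ -[RHS]E XY -opprD mulNrn -mulr2n -mulrnA mulNrn -opprD.
  by rewrite -mulrnDr.
have <- : rscal O 3 *: Q (Q (cc a)) = Q (Q (cc a)) *+ 3.
  by rewrite rmorph_nat scaler_nat.
by rewrite scaler0 scalerA -rmorphM mulVf ?pnatr_eq0 // rmorph1 scale1r.
Qed.

(** The factor [xi] here stands for the inverse of the gauge fixing parameter. The term in dc makes
    two contributions to Q^2 A, one through d(Qc) and one through the inner Q A, and they cancel;
    what remains is the adjoint matter square. *)
Lemma svf_sq_AA (xi : R) mu a :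
  (forall a, Q (AA a mu) = rscal O xi *: fpartial mu (cc a)
      + \sum_b \sum_c rscal O (g * f a b c) *: (cc b * AA c mu)) ->
  Q (Q (AA a mu)) = 0.
Proof.
move=> QA.
pose D := \sum_b \sum_c rscal O (g * f a b c) *: (cc b * fpartial mu (cc c)) : A.
(* The two Leibniz terms agree, by anticommutation and the antisymmetry of [f], which absorbs the
   factor 1/2. *)
have QD : fpartial mu (Q (cc a)) = D.
  pose h := \sum_b \sum_c rscal O (g / 2 * f a b c)
    *: (cc b * fpartial mu (cc c)) : A.
  have -> : D = h + h.
    rewrite -mulr2n -sumrMnl; apply: eq_bigr => b _.
    by rewrite -sumrMnl; apply: eq_bigr => c _; rewrite gZ.
  have {1}-> : h = - \sum_b \sum_c rscal O (g / 2 * f a b c)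
      *: (cc c * fpartial mu (cc b)).
    by rewrite /h struct_const_swap.
  rewrite -sumrN -big_split Qc.
  rewrite fpartial_sum; apply: eq_bigr => b _.
  rewrite -sumrN -big_split fpartial_sum; apply: eq_bigr => c _ /=.
  rewrite fpartialZ fpartialM scalerDr -scalerN; congr (_ *: _ + _).
  rewrite (fswap (homogeneous_partial mu (homogeneous_var _ _ (GaugeGhost b)))
    (homogeneous_var _ _ (GaugeGhost c))).
  by rewrite expr1 mulN1r.
rewrite QA linearD linearZ /= Q_partial QD.
have -> : Q (\sum_b \sum_c rscal O (g * f a b c) *: (cc b * AA c mu))
    = - (rscal O xi *: D).
  apply/eqP; rewrite -subr_eq0 opprK -[X in _ == X](matter_sq (AA^~ mu) a ad_rep).
  apply/eqP; rewrite linear_sum scaler_sumr -big_split; apply: eq_bigr => b _ /=.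
  rewrite linear_sum scaler_sumr -big_split; apply: eq_bigr => c _ /=.
  rewrite linearZ /= svf_ccM adE -rmorphM scalerA [rscal O xi * _]mulrC -scalerA -scalerDr.
  congr (_ *: _); rewrite QA mulrDr opprD scalerAr addrA addrAC addrNK.
  congr (_ - _ * _).
  apply: eq_bigr => d' _; apply: eq_bigr => k _.
  by rewrite adE -rmorphM.
by rewrite addrN.
Qed.

End GaugeSector.
End GaugeBRST.

(** * Representations with function entries, and nilpotency on every field *)

Lemma lie_rep_functions (R : realType) (d : nat) (O : coord_algebra R d)
    (gg : vectType R) (br : gg -> gg -> gg) n (t : n.-tuple gg) N
    (rho : gg -> 'M[R[i]]_N) (b c : 'I_n) :
  basis_of fullv t -> is_lie_rep br rho ->
  let M a := map_mx (scal O) (rho t`_a) in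
  M b *m M c - M c *m M b = \sum_(a < n) rscal O (struct_const br t a b c) *: M a.
Proof.
move=> ht hrho M.
rewrite -!map_mxM -map_mxB (lie_rep_struct_const ht _ _ hrho) map_mx_sum.
(* [rscal] is [scal] after [real_complex], so the real structure constants map to the required
   scalars. *)
by apply: eq_bigr => a _; rewrite map_mxZ.
Qed.

Theorem proposition4p3
    (R : realType) (d : nat) (O : coord_algebra R d)
    (gg : vectType R) (br : gg -> gg -> gg)
    (nG : nat) (t : nG.-tuple gg)
    (nH nS : nat) (HH : gg -> 'M[R[i]]_nH) (SS : gg -> 'M[R[i]]_nS)
    (kappa g xi : R)
    (hbr : is_lie_bracket br)
    (hgg : u1_plus_compact_semisimple br)
    (ht : basis_of fullv t)
    (hHH : is_lie_rep br HH)
    (hSS : is_lie_rep br SS)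
    (hxi : xi != 0)
    (Q : super_vector_field O nG nH nS kappa 0 1)
    (hQ : is_gauge_BRST br t HH SS g xi Q) :
  (forall F : functional O nG nH nS kappa,
     supercommutator Q Q F = Q (Q F) *+ 2 /\ Q (Q F) *+ 2 = 0)
  /\ cohomological snd Q.
Proof.
have Qc := brst_c hQ; have Qd := brst_partial hQ.
suff Q2 F : Q (Q F) = 0.
  have QQ F : supercommutator Q Q F = Q (Q F) *+ 2 /\ Q (Q F) *+ 2 = 0.
    by rewrite /supercommutator !Q2 mulr0 subr0 mul0rn.
  by split.
(* It remains to treat each field component; on the metric data, the auxiliary fields and the
   graviton ghosts already Q itself vanishes. *)
apply: svf_sq_eq0 F => //; case=> [mu nu|mu nu|mu nu|a mu|i|i|a|a|a|a|a|a].
- by rewrite [Q (fvar _)](brst_h hQ) linear0.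
- by rewrite [Q (fvar _)](svf_ginv (brst_h hQ)) linear0.
- by rewrite [Q (fvar _)](brst_e hQ) linear0.
- exact: (svf_sq_AA Qd hbr ht Qc a (fun b => brst_A hQ b mu)).
- apply: (svf_sq_matter Qc (y := HPhi) i (fun b c => lie_rep_functions O b c ht hHH)) => j.
  rewrite [LHS](brst_Phi hQ); apply: eq_bigr => a _; congr (_ *: (_ * _)).
  by apply: eq_bigr => k _; rewrite mxE.
- apply: (svf_sq_matter Qc (y := FPsi) i (fun b c => lie_rep_functions O b c ht hSS)) => j.
  rewrite [LHS](brst_Psi hQ); apply: eq_bigr => a _; congr (_ *: (_ * _)).
  by apply: eq_bigr => k _; rewrite mxE.
- by rewrite [Q (fvar _)](brst_B hQ) linear0.
- by rewrite [Q (fvar _)](brst_b hQ) linear0.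
- by rewrite [Q (fvar _)](brst_C hQ) linear0.
- by rewrite [Q (fvar _)](brst_Cbar hQ) linear0.
- exact: (svf_sq_cc hbr ht Qc).
- by rewrite [Q (fvar _)](brst_cbar hQ) linearZ /= (brst_b hQ); exact: scaler0.
Qed.
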